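(* Let $(X,d)$ be a geodesic space and let $\Phi:X\to\mathbb R\cup\{+\infty\}$ be a proper geodesically convex functional bounded from below. Let $p,q\in(1,+\infty)$ satisfy $p^{-1}+q^{-1}=1$. Let $T:X\to X$ be a mapping such that $$\Phi(v)\ge \Phi(T(v))+d(v,T(v))\qquad\forall v\in X.$$ Suppose further that there exist $u,\hat u\in X$ and $t>0$ such that $$\Phi(u)<\inf_{v\in X}\Phi(v)+t^{q/p}\quad\text{and}\quad \hat u\in\operatorname{prox}_{t\Phi}(u).$$ Then $\hat u$ is a fixed point of $T$, i.e. $T(\hat u)=\hat u$.
   Context: A geodesic space is a metric space $(X,d)$ such that for every $u,v\in X$ there is a constant-speed geodesic $\gamma:[0,1]\to X$ with $\gamma(0)=u$ and $\gamma(1)=v$, where constant-speed geodesic means $d(\gamma(s),\gamma(t))=|s-t|\,d(\gamma(0),\gamma(1))$ for all $s,t\in[0,1]$. Completeness is not assumed. A functional $\Phi:X\to\mathbb R\cup\{+\infty\}$ is proper if it is not identically $+\infty$. It is geodesically convex if for every $u,v\in X$ there is at least one constant-speed geodesic $\gamma:[0,1]\to X$ with $\gamma(0)=u$, $\gamma(1)=v$ and $\Phi(\gamma(t))\le(1-t)\Phi(\gamma(0))+t\Phi(\gamma(1))$ for all $t\in[0,1]$. Lower semicontinuity is not assumed. For a functional $\Psi:X\to\mathbb R\cup\{+\infty\}$, the (set-valued, possibly empty) proximal mapping with exponent $p$ is $$\operatorname{prox}_{\Psi}(u):=\operatorname*{arg\,min}_{v\in X}\Big\{\Psi(v)+\frac1p\,d(v,u)^p\Big\}.$$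 *)

(* Defs.v *)
From HB Require Import structures.
From mathcomp Require Import all_boot all_order all_algebra.
From mathcomp Require Import all_classical all_reals all_analysis.

Set Implicit Arguments.
Unset Strict Implicit.
Unset Printing Implicit Defensive.

Import Order.TTheory GRing.Theory Num.Theory.

Local Open Scope classical_set_scope.
Local Open Scope ring_scope.

(* A curve [0,1] -> X is represented by a total function R -> X of which only
   the values on [0,1] are constrained or used. *)
Definition cs_geodesic {R : realType} {X : metricType R} (gamma : R -> X) :
    Prop :=
  forall s t : R, 0 <= s <= 1 -> 0 <= t <= 1 ->
    mdist (gamma s) (gamma t) = `|s - t| * mdist (gamma 0) (gamma 1).

Definition geodesic_space {R : realType} (X : metricType R) : Prop :=
  forall u v : X, exists gamma : R -> X,
    [/\ cs_geodesic gamma, gamma 0 = u & gamma 1 = v].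

(* Functionals X -> R U {+oo} are functions into \bar R that avoid -oo. *)
Definition not_ninfty {R : realType} {X : metricType R} (Phi : X -> \bar R) :
    Prop :=
  forall v : X, Phi v != -oo%E.

Definition proper_functional {R : realType} {X : metricType R}
    (Phi : X -> \bar R) : Prop :=
  exists v : X, Phi v != +oo%E.

(* The bound is a real number: has_lbound (range Phi) in \bar R would hold
   trivially, with bound -oo. *)
Definition bounded_from_below {R : realType} {X : metricType R}
    (Phi : X -> \bar R) : Prop :=
  exists m : R, forall v : X, (m%:E <= Phi v)%E.

(* In \bar R, 0 * +oo = 0, so the inequality is trivial at t = 0 and t = 1 even
   if Phi is infinite at an endpoint. *)
Definition geodesically_convex {R : realType} {X : metricType R}
    (Phi : X -> \bar R) : Prop :=
  forall u v : X, exists gamma : R -> X,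
    [/\ cs_geodesic gamma, gamma 0 = u, gamma 1 = v &
      forall t : R, 0 <= t <= 1 ->
        (Phi (gamma t) <=
           (1 - t)%:E * Phi (gamma 0%R) + t%:E * Phi (gamma 1%R))%E].

Definition argmin {R : realType} {X : Type} (F : X -> \bar R) : set X :=
  [set v | forall w : X, (F v <= F w)%E].

Definition prox {R : realType} {X : metricType R} (p : R)
    (Psi : X -> \bar R) (u : X) : set X :=
  argmin (fun v => (Psi v + (p^-1 * mdist v u `^ p)%:E)%E).

(* Main.v *)
(* Write r := t^(q/p), so that r^(p-1) = t. If w := T uhat differs from uhat,
   then Phi decreases with slope at least 1 along a geodesic from uhat to w, and
   minimality of uhat forces t <= d(uhat,u)^(p-1), i.e. r <= d(uhat,u). Moving
   instead from uhat towards u, minimality gives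
   d(uhat,u)^p <= t (Phi u - Phi uhat) < t r = r^p, a contradiction.
   Derivatives of powers are replaced by the tangent inequality, which is
   Young's inequality. *)
Require Import Defs.
From HB Require Import structures.
From mathcomp Require Import all_boot all_order all_algebra.
From mathcomp Require Import all_classical all_reals all_analysis.
From mathcomp Require Import ring lra.

Import Order.TTheory GRing.Theory Num.Theory.

Local Open Scope classical_set_scope.
Local Open Scope ring_scope.

Set Implicit Arguments.
Unset Strict Implicit.

(** Young's inequality for [x] and y^(p-1), where (p-1)q = p. Geometrically, the graph of z^p/p lies
    above its tangent at [y], compared at [x]. *)
Lemma powR_tangent_le (R : realType) (p q x y : R) :
  1 < p -> 1 < q -> p^-1 + q^-1 = 1 -> 0 <= x -> 0 <= y ->
  p^-1 * (y `^ p - x `^ p) <= y `^ (p - 1) * (y - x).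
Proof.
move=> p1 q1 pq x0 y0.
have p0 : 0 < p by lra.
have q0 : 0 < q by lra.
have young := conjugate_powR x0 (powR_ge0 y (p - 1)) p0 q0 pq.
have pq1 : (p - 1) * q = p.
  have pN0 : p != 0 by rewrite gt_eqF.
  have qN0 : q != 0 by rewrite gt_eqF.
  have -> : (p - 1) * q = p * q * (1 - p^-1) by field.
  by rewrite -pq; field; rewrite pN0.
rewrite -powRrM pq1 in young.
have yp := mulr_powRB1 y0 p0.
have qE : q^-1 = 1 - p^-1 by rewrite -pq addrC addKr.
rewrite qE in young; nra.
Qed.

Section Prox.
Variables (R : realType) (X : metricType R) (Phi : X -> \bar R).
Variables (p t : R) (u uhat : X).
Hypotheses (Phi_not_ninfty : not_ninfty Phi) (t0 : 0 < t).
Hypothesis uhat_prox : prox p (fun v => (t%:E * Phi v)%E) u uhat.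

(** Comparison with the competitor [u], whose objective is finite; since t > 0, an infinite
    [Phi uhat] would make the objective at [uhat] infinite. *)
Lemma prox_fin_num : Phi u \is a fin_num -> Phi uhat \is a fin_num.
Proof.
move=> Phiu; have := uhat_prox u.
rewrite fin_numE Phi_not_ninfty/= -(fineK Phiu) -EFinM -EFinD.
by case: (Phi uhat) => // /=; rewrite gt0_muley ?lte_fin.
Qed.

(** Minimality of [uhat] against [gamma s], combined with convexity along [gamma]. It serves twice:
    with [w] equal to [T uhat], then to [u]. *)
Lemma prox_geodesic (w : X) (a c : R) :
  geodesically_convex Phi -> Phi uhat = a%:E -> Phi w = c%:E ->
  exists gamma : R -> X,
    [/\ cs_geodesic gamma, gamma 0 = uhat, gamma 1 = w &
      forall s, 0 <= s <= 1 ->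
        s * (t * (a - c)) <=
          p^-1 * (mdist (gamma s) u `^ p - mdist uhat u `^ p)].
Proof.
move=> cvx Ea Ec; have [g [g_geo g0 g1 g_cvx]] := cvx uhat w.
exists g; split => // s s01.
have := g_cvx s s01; have := uhat_prox (g s).
rewrite g0 g1 Ea Ec -!EFinM -!EFinD.
(* The finite convexity bound rules out the value [+oo] at [g s]. *)
have := Phi_not_ninfty (g s); case: (Phi (g s)) => // b _.
rewrite -!EFinM -!EFinD !lee_fin => min_g cvx_g.
have : t * b <= t * ((1 - s) * a + s * c) by rewrite ler_pM2l.
by lra.
Qed.

End Prox.

Theorem proposition1p10 (R : realType) (X : metricType R)
    (hX : geodesic_space X)
    (Phi : X -> \bar R)
    (hPhi : not_ninfty Phi)
    (hproper : proper_functional Phi)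
    (hconvex : geodesically_convex Phi)
    (hbelow : bounded_from_below Phi)
    (p q : R) (hp : 1 < p) (hq : 1 < q) (hpq : p^-1 + q^-1 = 1)
    (T : X -> X)
    (hT : forall v : X, (Phi (T v) + (mdist v (T v))%:E <= Phi v)%E)
    (u uhat : X) (t : R) (ht : 0 < t)
    (hu : (Phi u < ereal_inf (range Phi) + (t `^ (q / p))%:E)%E)
    (huhat : prox p (fun v => (t%:E * Phi v)%E) u uhat) :
  T uhat = uhat.
Proof.
apply/eqP; apply: contraT => Tu_neq.
have p0 : 0 < p by lra.
have q0 : 0 < q by lra.
have p10 : 0 < p - 1 by lra.
have Phiu : Phi u \is a fin_num.
  by rewrite fin_numE hPhi /= -ltey (lt_le_trans hu)// leey.
have Phiuhat := prox_fin_num hPhi ht huhat Phiu.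
set b := fine (Phi u); set a := fine (Phi uhat).
have Eb : Phi u = b%:E by rewrite fineK.
have Ea : Phi uhat = a%:E by rewrite fineK.
set r := t `^ (q / p) in hu.
have r0 : 0 < r by exact: powR_gt0.
(* The exponents q/p and p-1 are reciprocal: their product is q(1 - 1/p) = 1. *)
have rp1 : r `^ (p - 1) = t.
  rewrite /r -powRrM.
  suff -> : q / p * (p - 1) = 1 by rewrite powRr1// ltW.
  have -> : q / p * (p - 1) = q * (1 - p^-1) by field; rewrite gt_eqF.
  by rewrite -hpq addrC addKr divff// gt_eqF.
have bar : b < a + r.
  rewrite -lte_fin EFinD -Eb -Ea (lt_le_trans hu)// leeD2r//.
  by apply: ereal_inf_lbound; exists uhat.
set D := mdist uhat u.
have D0 : 0 <= D by exact: mdist_ge0.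
have le_powR1 (x y : R) :
    0 <= x -> 0 <= y -> x `^ (p - 1) <= y `^ (p - 1) -> x <= y.
  move=> x0 y0; apply: contraTT; rewrite -!ltNge => yx.
  by rewrite gt0_ltr_powR.
have rD : r <= D.
  set L := mdist uhat (T uhat).
  have L0 : 0 < L by rewrite mdist_gt0 eq_sym.
  have [c Ec cL] : exists2 c, Phi (T uhat) = c%:E & c + L <= a.
    have := hT uhat; have := hPhi (T uhat); rewrite Ea.
    by case: (Phi (T uhat)) => // c _; rewrite -EFinD lee_fin; exists c.
  have [g [g_geo g0 g1 g_prox]] := prox_geodesic hPhi ht huhat hconvex Ea Ec.
  (* Since [g s] is within [D + s * L] of [u] and [L <= a - c], the tangent inequality at this
     radius, divided by [s * L], gives t <= (D + sL)^(p-1). *)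
  have step s : 0 < s <= 1 -> r <= D + s * L.
    move=> /andP[s0 s1]; have s01 : 0 <= s <= 1 by rewrite ltW.
    have gD : mdist (g s) u <= D + s * L.
      rewrite addrC (le_trans (metric_triangle _ uhat _))// lerD2r.
      have := g_geo s 0 s01; rewrite lexx ler01 => /(_ isT).
      by rewrite g0 g1 subr0 (gtr0_norm s0) => ->.
    have y0 : 0 <= D + s * L by nra.
    have gp : mdist (g s) u `^ p <= (D + s * L) `^ p.
      by rewrite ge0_ler_powR ?nnegrE ?mdist_ge0 ?(ltW p0).
    have tgt := powR_tangent_le hp hq hpq D0 y0.
    have := g_prox s s01; rewrite -/D => gs.
    apply: le_powR1 => //; first exact: ltW.
    have pV : 0 < p^-1 by rewrite invr_gt0.
    have e1 : s * (t * L) <= s * (t * (a - c)).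
      by rewrite ler_pM2l// ler_pM2l//; lra.
    have e2 : p^-1 * (mdist (g s) u `^ p - D `^ p) <=
              p^-1 * ((D + s * L) `^ p - D `^ p) by rewrite ler_pM2l// lerD2r.
    have sL : 0 < s * L by exact: mulr_gt0.
    rewrite rp1 -(ler_pM2r sL).
    have -> : t * (s * L) = s * (t * L) by ring.
    apply: (le_trans e1); apply: (le_trans gs); apply: (le_trans e2).
    by apply: (le_trans tgt); rewrite addrAC subrr add0r.
  rewrite leNgt; apply/negP => Dr.
  have rDL : 0 < (r - D) / (2 * L) by rewrite divr_gt0 ?subr_gt0 ?mulr_gt0.
  (* In place of the limit s -> 0: this parameter makes sL at most half the gap r - D, and the
     minimum with 1 keeps it in (0,1]. *)
  have := step (Num.min 1 ((r - D) / (2 * L))).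
  rewrite lt_min ltr01 rDL ge_min lexx => /(_ isT).
  have : Num.min 1 ((r - D) / (2 * L)) * L <= (r - D) / 2.
    have -> : (r - D) / 2 = (r - D) / (2 * L) * L by field; rewrite gt_eqF.
    by rewrite ler_pM2r// ge_min lexx orbT.
  lra.
have Dpos : 0 < D by lra.
have [g [g_geo g0 g1 g_prox]] := prox_geodesic hPhi ht huhat hconvex Ea Eb.
(* The point [g (1 - x)] is at distance xD from [u]; the tangent inequality at xD is divided by 1 -
   x, hence x < 1. *)
have step x : 0 <= x < 1 -> (x * D) `^ (p - 1) * D <= t * (b - a).
  move=> /andP[x0 x1].
  have s01 : 0 <= 1 - x <= 1 by lra.
  have gs := g_prox _ s01.
  have gD : mdist (g (1 - x)) u = x * D.
    have := g_geo (1 - x) 1 s01; rewrite lexx ler01 => /(_ isT).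
    rewrite g0 g1 => ->; congr (_ * _).
    by rewrite ler0_norm; lra.
  have xD : 0 <= x * D by exact: mulr_ge0.
  have := powR_tangent_le hp hq hpq D0 xD.
  rewrite gD -/D in gs; move=> tgt.
  have s0 : 0 < 1 - x by lra.
  rewrite -(ler_pM2l s0); nra.
have ab : 0 <= b - a.
  rewrite -(pmulr_rge0 _ ht); apply: le_trans (step 0 _).
    by rewrite mulr_ge0 ?powR_ge0.
  by rewrite lexx ltr01.
have xr : (b - a) / r < 1 by rewrite ltr_pdivrMr//; lra.
have br0 : 0 <= (b - a) / r by rewrite divr_ge0// ltW.
(* In place of the limit x -> 1: [x0] solves x^(p-1) = (b-a)/r and is below 1 because b - a < r. The
   midpoint of [x0] and 1 then satisfies both x < 1 and x^(p-1) > (b-a)/r. *)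
set x0 := ((b - a) / r) `^ (p - 1)^-1.
have x01 : x0 < 1.
  have e1 : 1 `^ (p - 1)^-1 = 1 :> R by rewrite powR1.
  rewrite -[ltRHS]e1.
  by rewrite gt0_ltr_powR ?nnegrE ?invr_gt0 ?ler01.
have x00 : 0 <= x0 by exact: powR_ge0.
have x0E : x0 `^ (p - 1) = (b - a) / r.
  by rewrite -powRrM mulVf ?gt_eqF// powRr1.
pose x := (x0 + 1) / 2.
have stepx : (x * D) `^ (p - 1) * D <= t * (b - a).
  by apply: step; rewrite /x; lra.
have xx : (b - a) / r < x `^ (p - 1).
  by rewrite -x0E gt0_ltr_powR ?nnegrE ?/x; lra.
(* Here r <= D enters through t = r^(p-1) <= D^(p-1). *)
have xp : t * x `^ (p - 1) <= (x * D) `^ (p - 1).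
  rewrite powRM ?(ltW Dpos)//; last by rewrite /x; lra.
  rewrite mulrC ler_wpM2l ?powR_ge0// -rp1.
  by rewrite ge0_ler_powR ?nnegrE ?(ltW p10) ?(ltW r0).
have : t * (b - a) < (x * D) `^ (p - 1) * D.
  apply: (@lt_le_trans _ _ (t * x `^ (p - 1) * r)).
    by rewrite -mulrA ltr_pM2l// -ltr_pdivrMr.
  apply: ler_pM => //; last exact: ltW.
  exact: mulr_ge0 (ltW ht) (powR_ge0 _ _).
by rewrite ltNge stepx.
Qed.
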